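(* Let $n>p\ge 1$ be integers, let $A\in\mathbb{R}^{n\times n}$ be symmetric with eigenvalues $\lambda_1<\lambda_2<\cdots<\lambda_p<\lambda_{p+1}\le\cdots\le\lambda_n$, let $\mu>0$, and let $W=\mathrm{diag}(w_1,\dots,w_p)$ be a real diagonal matrix with $w_1>w_2>\cdots>w_p>\lambda_p/\mu$. Let $f_{\mu,W}:\mathbb{R}^{n\times p}\to\mathbb{R}$ be $$f_{\mu,W}(X)=\tfrac12\mathrm{tr}(X^\top AX)+\tfrac{\mu}{4}\|X^\top X-W\|_{\mathrm F}^2 .$$ Then $f_{\mu,W}$ has no local minima other than its global minimizers; that is, every local minimizer of $f_{\mu,W}$ on $\mathbb{R}^{n\times p}$ is a global minimizer.
   Context: $\|\cdot\|_{\mathrm F}$ is the Frobenius norm. *)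

(* Defs.v *)
From mathcomp Require Import all_boot all_order all_algebra.
From mathcomp Require Import all_classical all_reals all_analysis.

Set Implicit Arguments.
Unset Strict Implicit.
Unset Printing Implicit Defensive.

Import Order.TTheory GRing.Theory Num.Theory.
Import numFieldNormedType.Exports.

Local Open Scope ring_scope.
Local Open Scope classical_set_scope.

(* The library's norm on matrices is the entrywise maximum, not this one. *)
Definition frob_norm (R : realType) (m n : nat) (M : 'M[R]_(m, n)) : R :=
  Num.sqrt (\sum_i \sum_j M i j ^+ 2).

Definition trace_penalty (R : realType) (n p : nat) (A : 'M[R]_n) (mu : R)
    (W : 'M[R]_p) (X : 'M[R]_(n, p)) : R :=
  1 / 2 * \tr (X^T *m A *m X) + mu / 4 * frob_norm (X^T *m X - W) ^+ 2.

Definition local_minimizer (R : realType) (T : topologicalType) (f : T -> R)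
    (x : T) : Prop :=
  \forall y \near x, f x <= f y.

Definition global_minimizer (R : realType) (T : Type) (f : T -> R)
    (x : T) : Prop :=
  forall y, f x <= f y.

(* Main.v *)
Require Import Defs.
From mathcomp Require Import all_boot all_order all_algebra.
From mathcomp Require Import all_classical all_reals all_analysis.
From mathcomp Require Import ring lra.

Set Implicit Arguments.
Unset Strict Implicit.
Unset Printing Implicit Defensive.

Import Order.TTheory GRing.Theory Num.Theory.
Import numFieldNormedType.Exports.

Local Open Scope ring_scope.
Local Open Scope classical_set_scope.

(** Along a line [X + t H] the objective is a quartic polynomial in [t], so at
    a local minimizer [X] the gradient vanishes and the Hessian is nonnegative
    ([local_minimizer_derivatives]).

    The gradient equation reads [A X = mu X (W - X^T X)].  Multiplied by [X^T]
    on the left it shows that [X^T X W] is symmetric, so [X^T X] commutes with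
    [W]; as the entries of [W] are distinct, [X^T X] is diagonal.  Hence the
    columns [x_i] are orthogonal and, when nonzero, eigenvectors of [A] for
    [nu_i = mu (w_i - |x_i|^2)].  The Hessian yields three more facts.
    - Moving [x_i] in a direction [u] orthogonal to all columns gives
      [<u, A u> >= nu_i |u|^2] ([local_minimizer_perp]).
    - No column vanishes: otherwise the span of the eigenvectors of
      [lambda_1, ..., lambda_p], of dimension [p], would contain some [u <> 0]
      orthogonal to all the columns, with
      [<u, A u> <= lambda_p |u|^2 < mu w_i |u|^2]
      ([local_minimizer_gram_gt0]).
    - Mixing [x_i] and [x_j] inside their plane forces [nu_i <= nu_j] for
      [i < j] ([local_minimizer_ordered]).

    So the columns of [X] are orthogonal eigenvectors in the order of their
    eigenvalues, and [A] is at least [nu_p] on their orthogonal complement.  By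
    the Courant-Fischer argument this determines all the [nu_i]
    ([lowest_eigenframe_le]), hence the norms [|x_i|], hence the value of the
    objective ([trace_penalty_eigenframe]).  All local minimizers therefore
    share one value.  The objective is coercive and so has a global minimizer
    ([trace_penalty_attains_min]); being local too, it has that same value,
    and every local minimizer is global. *)

(** * The Frobenius inner product *)

Definition frob_dot (R : realType) (m n : nat) (M N : 'M[R]_(m, n)) : R :=
  \tr (M^T *m N).

Lemma frob_dotE (R : realType) (m n : nat) (M N : 'M[R]_(m, n)) :
  frob_dot M N = \sum_i \sum_j M i j * N i j.
Proof.
rewrite /frob_dot /mxtrace exchange_big; apply: eq_bigr => j _; rewrite mxE.
by apply: eq_bigr => i _; rewrite mxE.
Qed.

Lemma frob_dotC (R : realType) (m n : nat) (M N : 'M[R]_(m, n)) :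
  frob_dot M N = frob_dot N M.
Proof. by rewrite /frob_dot -mxtrace_tr trmx_mul trmxK. Qed.

Lemma frob_dotDr (R : realType) (m n : nat) (M N P : 'M[R]_(m, n)) :
  frob_dot M (N + P) = frob_dot M N + frob_dot M P.
Proof. by rewrite /frob_dot mulmxDr mxtraceD. Qed.

Lemma frob_dotZr (R : realType) (m n : nat) (a : R) (M N : 'M[R]_(m, n)) :
  frob_dot M (a *: N) = a * frob_dot M N.
Proof. by rewrite /frob_dot -scalemxAr mxtraceZ. Qed.

Lemma frob_dotDl (R : realType) (m n : nat) (M N P : 'M[R]_(m, n)) :
  frob_dot (M + N) P = frob_dot M P + frob_dot N P.
Proof. by rewrite frob_dotC frob_dotDr !(frob_dotC P). Qed.

Lemma frob_dotZl (R : realType) (m n : nat) (a : R) (M N : 'M[R]_(m, n)) :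
  frob_dot (a *: M) N = a * frob_dot M N.
Proof. by rewrite frob_dotC frob_dotZr (frob_dotC N). Qed.

Lemma frob_dot0r (R : realType) (m n : nat) (M : 'M[R]_(m, n)) :
  frob_dot M 0 = 0.
Proof. by rewrite /frob_dot mulmx0 mxtrace0. Qed.

Lemma frob_dot_mull (R : realType) (m n q : nat) (B : 'M[R]_(m, q))
    (M : 'M[R]_(q, n)) (N : 'M[R]_(m, n)) :
  frob_dot (B *m M) N = frob_dot M (B^T *m N).
Proof. by rewrite /frob_dot trmx_mul mulmxA. Qed.

Lemma frob_dot_mulr (R : realType) (m n q : nat) (B : 'M[R]_(q, n))
    (M : 'M[R]_(m, q)) (N : 'M[R]_(m, n)) :
  frob_dot (M *m B) N = frob_dot M (N *m B^T).
Proof. by rewrite /frob_dot trmx_mul -mulmxA mxtrace_mulC mulmxA. Qed.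

Lemma frob_dot_ge0 (R : realType) (m n : nat) (M : 'M[R]_(m, n)) :
  0 <= frob_dot M M.
Proof.
by rewrite frob_dotE; do 2![apply: sumr_ge0 => ? _]; rewrite -expr2 sqr_ge0.
Qed.

Lemma sqr_entry_le_frob_dot (R : realType) (m n : nat) (M : 'M[R]_(m, n)) i j :
  M i j ^+ 2 <= frob_dot M M.
Proof.
have ge0 k l : 0 <= M k l * M k l by rewrite -expr2 sqr_ge0.
rewrite frob_dotE (bigD1 i) //= (bigD1 j) //= -expr2 -addrA lerDl.
by apply: addr_ge0; apply: sumr_ge0 => // k _; apply: sumr_ge0.
Qed.

Lemma frob_dot_eq0 (R : realType) (m n : nat) (M : 'M[R]_(m, n)) :
  frob_dot M M = 0 -> M = 0.
Proof.
move=> M0; apply/matrixP => i j; rewrite mxE.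
have := sqr_entry_le_frob_dot M i j; rewrite M0 => le0.
by apply/eqP; rewrite -sqrf_eq0 eq_le le0 sqr_ge0.
Qed.

Lemma frob_norm_sqr (R : realType) (m n : nat) (M : 'M[R]_(m, n)) :
  frob_norm M ^+ 2 = frob_dot M M.
Proof.
rewrite /frob_norm sqr_sqrtr; last by do 2![apply: sumr_ge0 => ? _]; exact: sqr_ge0.
rewrite frob_dotE; by do 2![apply: eq_bigr => ? _]; rewrite expr2.
Qed.

(** * The objective along a line *)

Lemma trace_penaltyE (R : realType) (n p : nat) (A : 'M[R]_n) (mu : R)
    (W : 'M[R]_p) (X : 'M[R]_(n, p)) :
  trace_penalty A mu W X = 2^-1 * frob_dot X (A *m X)
    + mu / 4 * frob_dot (X^T *m X - W) (X^T *m X - W).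
Proof. by rewrite /trace_penalty frob_norm_sqr div1r /frob_dot mulmxA. Qed.

(** The Gram matrix minus [W] moves as [S + t B + t^2 C], which makes the
    objective a quartic in [t]; the Horner form is the one that peels off one
    derivative at a time.  Symmetry of [A] and [W] merges the two cross terms
    of each product into one. *)
Lemma trace_penalty_line (R : realType) (n p : nat) (A : 'M[R]_n) (mu : R)
    (W : 'M[R]_p) (X H : 'M[R]_(n, p)) (t : R) :
  A^T = A -> W^T = W ->
  let S := X^T *m X - W in
  let B := X^T *m H + H^T *m X in
  let C := H^T *m H in
  trace_penalty A mu W (X + t *: H) = trace_penalty A mu W X
    + t * (frob_dot H (A *m X + mu *: (X *m S))
    + t * (2^-1 * frob_dot H (A *m H + mu *: (H *m S)) + mu / 4 * frob_dot B B
    + t * (mu / 2 * frob_dot B C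
    + t * (mu / 4 * frob_dot C C)))).
Proof.
move=> symA symW S B C.
have symS : S^T = S by rewrite /S linearB /= trmx_mul trmxK symW.
have gramE : (X + t *: H)^T *m (X + t *: H) - W = S + t *: B + t ^+ 2 *: C.
  have -> : (X + t *: H)^T = X^T + t *: H^T by rewrite linearD linearZ.
  rewrite mulmxDl !mulmxDr -!scalemxAl -!scalemxAr scalerA.
  rewrite /S /B /C.
  move: (X^T *m X) (X^T *m H) (H^T *m X) (H^T *m H) => G1 G2 G3 G4.
  by apply/matrixP => i j; rewrite !mxE; ring.
have SB : frob_dot S B = 2 * frob_dot H (X *m S).
  have e (P Q : 'M[R]_(n, p)) : frob_dot S (P^T *m Q) = frob_dot P (Q *m S).
    by rewrite -frob_dot_mull frob_dot_mulr symS.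
  rewrite /B frob_dotDr !e (frob_dotC X) frob_dot_mulr symS; ring.
have SC : frob_dot S C = frob_dot H (H *m S).
  by rewrite /C -frob_dot_mull frob_dot_mulr symS.
have AH : frob_dot X (A *m H) = frob_dot H (A *m X).
  by rewrite -{1}symA -frob_dot_mull frob_dotC.
rewrite !trace_penaltyE gramE mulmxDr -scalemxAr -/S.
clearbody S B C; clear gramE symS.
rewrite !(frob_dotDl, frob_dotDr, frob_dotZl, frob_dotZr) AH.
rewrite (frob_dotC B S) (frob_dotC C S) (frob_dotC C B) SB SC.
by field.
Qed.

(** The perturbation [t * h t] is at most [K t], hence smaller than any given
    margin for small [t > 0], so it cannot compensate a negative [a]. *)
Lemma ge0_of_vanishing_perturbation (R : realType) (e a : R) (h : R -> R) (K : R) :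
  0 < e -> (forall t, 0 < t < e -> t <= 1 -> `|h t| <= K) ->
  (forall t, 0 < t < e -> 0 <= a + t * h t) -> 0 <= a.
Proof.
move=> e_gt0 hK ah; rewrite leNgt; apply/negP => a_lt0.
have K1_gt0 : 0 < `|K| + 1 by rewrite ltr_wpDl.
(* small enough that the perturbation is at most half of [- a] *)
pose t := Num.min (e / 2) (Num.min 1 (- a / (2 * (`|K| + 1)))).
have t_gt0 : 0 < t by rewrite !lt_min; apply/and3P; split; rewrite ?divr_gt0 ?oppr_gt0 ?mulr_gt0.
have t_lt : 0 < t < e.
  by rewrite t_gt0 /t gt_min (_ : e / 2 < e) // ltr_pdivrMr // mulr_natr mulr2n ltrDl.
have t_le1 : t <= 1 by rewrite /t !ge_min lexx orbT.
have t_leK : t * (`|K| + 1) <= - a / 2.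
  have : t <= - a / (2 * (`|K| + 1)) by rewrite /t !ge_min lexx !orbT.
  rewrite invfM mulrA => /le_trans/(_ (lexx _)).
  by rewrite ler_pdivlMr.
have := ah _ t_lt; have := hK _ t_lt t_le1; rewrite ler_norml => /andP[_ hle].
have : t * h t <= t * (`|K| + 1).
  by rewrite ler_pM2l //; apply: le_trans hle _; have := ler_norm K; lra.
by lra.
Qed.

(** First and second order conditions for a polynomial: dividing by [t] of
    either sign kills [a1], then dividing by [t^2] bounds [a2]. *)
Lemma quartic_local_min (R : realType) (e a1 a2 a3 a4 : R) :
  0 < e -> (forall t, `|t| < e -> 0 <= t * (a1 + t * (a2 + t * (a3 + t * a4)))) ->
  a1 = 0 /\ 0 <= a2.
Proof.
move=> e_gt0 tP.
have bound3 b2 b3 b4 t : 0 < t < e -> t <= 1 ->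
    `|b2 + t * (b3 + t * b4)| <= `|b2| + `|b3| + `|b4|.
  move=> /andP[t_gt0 _] t_le1; rewrite -addrA.
  have nt b : `|t * b| <= `|b|.
    by rewrite normrM gtr0_norm // ler_piMl.
  apply: le_trans (ler_normD _ _) _; rewrite lerD2l.
  apply: le_trans (nt _) _; apply: le_trans (ler_normD _ _) _.
  by rewrite lerD2l.
have a1_ge0 : 0 <= a1.
  apply: (ge0_of_vanishing_perturbation e_gt0 (bound3 a2 a3 a4)) => t /[dup] t_e.
  move=> /andP[t_gt0 t_lt]; have := tP t; rewrite gtr0_norm // => /(_ t_lt).
  by rewrite pmulr_rge0.
have a1_le0 : 0 <= - a1.
  apply: (ge0_of_vanishing_perturbation e_gt0 (bound3 a2 (- a3) a4)) => t /[dup] t_e.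
  move=> /andP[t_gt0 t_lt]; have := tP (- t); rewrite normrN gtr0_norm // => /(_ t_lt).
  rewrite mulNr oppr_ge0 pmulr_rle0 // => ?.
  by lra.
have a10 : a1 = 0 by lra.
split=> //.
apply: (ge0_of_vanishing_perturbation e_gt0 (bound3 a3 a4 0)) => t /[dup] t_e.
move=> /andP[t_gt0 t_lt]; have := tP t; rewrite gtr0_norm // => /(_ t_lt).
by rewrite a10 add0r !pmulr_rge0 // mulr0 addr0.
Qed.

Lemma local_minimizer_line (R : realType) (n p : nat)
    (f : 'M[R]_(n, p) -> R) (X H : 'M[R]_(n, p)) :
  local_minimizer f X ->
  exists2 e : R, 0 < e & forall t, `|t| < e -> f X <= f (X + t *: H).
Proof.
move=> Xmin.
have : (fun t : R => X + t *: H) @ (0 : R) --> X + 0 *: H.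
  by apply: cvgD; [exact: cvg_cst | apply: cvgZr_tmp; exact: cvg_id].
rewrite scale0r addr0 => Hline.
have /nbhs_ballP[e /= e_gt0 eP] := Hline _ Xmin.
by exists e => // t t_e; apply: eP; rewrite /ball /= sub0r normrN.
Qed.

(** The gradient is [A X + mu X S]; it is orthogonal to every [H], in
    particular to itself.  The second part is the Hessian on [H]. *)
Lemma local_minimizer_derivatives (R : realType) (n p : nat) (A : 'M[R]_n)
    (mu : R) (W : 'M[R]_p) (X : 'M[R]_(n, p)) :
  A^T = A -> W^T = W -> local_minimizer (trace_penalty A mu W) X ->
  let S := X^T *m X - W in
  A *m X = - mu *: (X *m S) /\
  forall H, let B := X^T *m H + H^T *m X in
    0 <= 2^-1 * frob_dot H (A *m H + mu *: (H *m S)) + mu / 4 * frob_dot B B.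
Proof.
move=> symA symW Xmin S.
have der H : frob_dot H (A *m X + mu *: (X *m S)) = 0 /\
    0 <= 2^-1 * frob_dot H (A *m H + mu *: (H *m S))
      + mu / 4 * frob_dot (X^T *m H + H^T *m X) (X^T *m H + H^T *m X).
  have [e e_gt0 eP] := local_minimizer_line H Xmin.
  apply: (quartic_local_min e_gt0) => t /eP.
  rewrite trace_penalty_line // lerDl; exact.
split=> [|H]; last exact: (der H).2.
have /frob_dot_eq0 /eqP := (der (A *m X + mu *: (X *m S))).1.
by rewrite addr_eq0 -scaleNr => /eqP.
Qed.

(** * Orthogonal frames of eigenvectors *)

Definition eigenframe (R : realType) (n p : nat) (A : 'M[R]_n)
    (X : 'M[R]_(n, p)) (s nu : 'rV[R]_p) : Prop :=
  [/\ X^T *m X = diag_mx s, forall i, 0 < s 0 i & A *m X = X *m diag_mx nu].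

(** Eigenvectors for the [p] smallest eigenvalues of [A], in increasing order.
    That no smaller eigenvalue is missing is expressed by the bound on the
    orthogonal complement, which avoids diagonalizing all of [A]. *)
Definition lowest_eigenframe (R : realType) (n p : nat) (A : 'M[R]_n)
    (X : 'M[R]_(n, p)) (s nu : 'rV[R]_p) : Prop :=
  [/\ eigenframe A X s nu,
      forall i j : 'I_p, (i <= j)%N -> nu 0 i <= nu 0 j &
      forall (u : 'cV[R]_n) i, X^T *m u = 0 ->
        nu 0 i * frob_dot u u <= frob_dot u (A *m u)].

Lemma frob_dot_diag (R : realType) (m n : nat) (d : 'rV[R]_m)
    (M N : 'M[R]_(m, n)) :
  frob_dot M (diag_mx d *m N) = \sum_i \sum_j d 0 i * (M i j * N i j).
Proof.
rewrite frob_dotE; do 2![apply: eq_bigr => ? _].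
by rewrite mul_diag_mx mxE mulrCA.
Qed.

(** The frame diagonalizes both the inner product and the quadratic form of
    [A] on its span. *)
Lemma eigenframe_dot_span (R : realType) (n p : nat) (A : 'M[R]_n)
    (X : 'M[R]_(n, p)) (s nu : 'rV[R]_p) (c : 'cV[R]_p) :
  eigenframe A X s nu ->
  frob_dot (X *m c) (X *m c) = \sum_i s 0 i * c i 0 ^+ 2 /\
  frob_dot (X *m c) (A *m (X *m c)) = \sum_i nu 0 i * (s 0 i * c i 0 ^+ 2).
Proof.
case=> XX _ AX; rewrite mulmxA AX -mulmxA !frob_dot_mull !(mulmxA X^T) XX.
rewrite !frob_dot_diag; split; apply: eq_bigr => i _; rewrite big_ord1 ?expr2 //.
by rewrite mul_diag_mx mxE; ring.
Qed.

Lemma eigenframe_span_gt0 (R : realType) (n p : nat) (A : 'M[R]_n)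
    (X : 'M[R]_(n, p)) (s nu : 'rV[R]_p) (c : 'cV[R]_p) :
  eigenframe A X s nu -> c != 0 -> 0 < frob_dot (X *m c) (X *m c).
Proof.
move=> XF c_neq0; have [_ s_gt0 _] := XF.
have [i ci] : exists i, c i 0 != 0.
  apply/existsP; apply: contra_neqT c_neq0; rewrite negb_exists => /forallP c0.
  by apply/matrixP => i j; rewrite ord1 mxE; apply/eqP; have := c0 i; rewrite negbK.
rewrite (eigenframe_dot_span c XF).1 (bigD1 i) //= ltr_wpDr //.
  by apply: sumr_ge0 => k _; rewrite mulr_ge0 ?sqr_ge0 // ltW.
by rewrite mulr_gt0 // lt_def sqrf_eq0 ci sqr_ge0.
Qed.

Lemma eigenframe_rayleigh_le (R : realType) (n p : nat) (A : 'M[R]_n)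
    (X : 'M[R]_(n, p)) (s nu : 'rV[R]_p) (c : 'cV[R]_p) (m : R) :
  eigenframe A X s nu -> (forall i, c i 0 != 0 -> nu 0 i <= m) ->
  frob_dot (X *m c) (A *m (X *m c)) <= m * frob_dot (X *m c) (X *m c).
Proof.
move=> XF nu_le; have [_ s_gt0 _] := XF; have [-> ->] := eigenframe_dot_span c XF.
rewrite mulr_sumr; apply: ler_sum => i _.
have [-> | /nu_le] := eqVneq (c i 0) 0; first by rewrite expr2 !(mulr0, mul0r).
by apply: ler_wpM2r; rewrite mulr_ge0 ?sqr_ge0 // ltW.
Qed.

(** Split [v] into its projection [X c] on the span of the frame and a
    remainder [u] orthogonal to it; the span is invariant under [A], so the
    quadratic form has no cross term.  The projection uses only columns with
    eigenvalue at least [nu_i], and the remainder is covered by the bound on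
    the complement. *)
Lemma lowest_eigenframe_rayleigh_ge (R : realType) (n p : nat) (A : 'M[R]_n)
    (X : 'M[R]_(n, p)) (s nu : 'rV[R]_p) (v : 'cV[R]_n) (i : 'I_p) :
  A^T = A -> lowest_eigenframe A X s nu ->
  (forall j : 'I_p, (j < i)%N -> (X^T *m v) j 0 = 0) ->
  nu 0 i * frob_dot v v <= frob_dot v (A *m v).
Proof.
move=> symA [XF nu_mono nu_perp] v_perp; have [XX s_gt0 AX] := XF.
pose c : 'cV[R]_p := \col_j ((X^T *m v) j 0 / s 0 j).
pose u := v - X *m c.
have Xu : X^T *m u = 0.
  apply/matrixP => j k; rewrite ord1 /u mulmxBr mulmxA XX mul_diag_mx !mxE.
  by rewrite mulrC divfK ?subrr // gt_eqF.
have vE : v = X *m c + u by rewrite /u addrC subrK.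
clearbody u; rewrite {}vE mulmxDr !(frob_dotDl, frob_dotDr).
have Xcu : frob_dot (X *m c) u = 0 by rewrite frob_dot_mull Xu frob_dot0r.
have uXc : frob_dot u (X *m c) = 0 by rewrite frob_dotC.
have uAXc : frob_dot u (A *m (X *m c)) = 0.
  by rewrite mulmxA AX -mulmxA frob_dotC frob_dot_mull Xu frob_dot0r.
have XcAu : frob_dot (X *m c) (A *m u) = 0.
  by rewrite -{1}symA -frob_dot_mull frob_dotC.
rewrite Xcu uXc uAXc XcAu !(addr0, add0r) mulrDr lerD //; last exact: nu_perp.
have [-> ->] := eigenframe_dot_span c XF.
rewrite mulr_sumr; apply: ler_sum => j _.
have [ji | ij] := ltnP j i; first by rewrite mxE v_perp // mul0r expr2 !(mulr0, mul0r).
by apply: ler_wpM2r; [rewrite mulr_ge0 ?sqr_ge0 // ltW | exact: nu_mono].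
Qed.

(** Dimension counting in the form used below: [p] unknowns and at most
    [p - 1] nontrivial linear equations leave a nonzero solution. *)
Lemma kernel_of_zero_row (R : realType) (p : nat) (M : 'M[R]_p) (i : 'I_p) :
  (forall j, M i j = 0) -> exists2 c : 'cV[R]_p, c != 0 & M *m c = 0.
Proof.
move=> Mi; have : \det M^T == 0.
  rewrite det_tr (expand_det_row M i); apply/eqP.
  by apply: big1 => j _; rewrite Mi mul0r.
case/det0P => v v_neq0 vM; exists v^T; first by rewrite trmx_eq0.
by rewrite -[M]trmxK -trmx_mul vM trmx0.
Qed.

(** Courant-Fischer: the span of the first [i + 1] columns of [X] has
    dimension [i + 1], so it contains some [v <> 0] orthogonal to the first [i]
    columns of [Z].  The Rayleigh quotient of [v] is at most [nu_i] by the
    first property and at least [nu'_i] by the second. *)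
Lemma lowest_eigenframe_le (R : realType) (n p : nat) (A : 'M[R]_n)
    (X Z : 'M[R]_(n, p)) (s nu s' nu' : 'rV[R]_p) (i : 'I_p) :
  A^T = A -> lowest_eigenframe A X s nu -> lowest_eigenframe A Z s' nu' ->
  nu' 0 i <= nu 0 i.
Proof.
move=> symA [XF nu_mono _] ZF.
(* Rows above [i] ask for orthogonality to the columns of [Z], rows below
   [i] for the vanishing of the later coordinates; row [i] is free. *)
pose M : 'M[R]_p := \matrix_(j, k)
  if (j < i)%N then (Z^T *m X) j k else if j == i then 0 else (j == k)%:R.
have [k | c c_neq0 Mc] := @kernel_of_zero_row _ _ M i.
  by rewrite mxE ltnn eqxx.
have Mj j : \sum_k M j k * c k 0 = 0.
  by move/matrixP/(_ j 0): Mc; rewrite !mxE.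
have c_above (j : 'I_p) : (i < j)%N -> c j 0 = 0.
  move=> ij; have ji : (j == i) = false by rewrite -val_eqE /= gtn_eqF.
  have := Mj j; rewrite (bigD1 j) //= big1 => [|k kj].
    by rewrite addr0 mxE ltnNge ltnW //= ji eqxx mul1r.
  by rewrite mxE ltnNge ltnW //= ji eq_sym (negPf kj) mul0r.
have := eigenframe_span_gt0 XF c_neq0.
move/ler_pM2r => <-; apply: le_trans (eigenframe_rayleigh_le XF _); last first.
  move=> k ck; apply: nu_mono; rewrite leqNgt.
  by apply: contra_neqN ck; exact: c_above.
apply: (lowest_eigenframe_rayleigh_ge symA ZF) => j jlt.
rewrite mulmxA mxE -[RHS](Mj j); apply: eq_bigr => k _.
by rewrite [M j k]mxE jlt.
Qed.

(** * Local minimizers are lowest eigenframes *)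

Lemma sum_two_entries (R : realType) (p : nat) (F : 'I_p -> 'I_p -> R)
    (i j : 'I_p) :
  i != j ->
  (forall k l, (k, l) != (i, j) -> (k, l) != (j, i) -> F k l = 0) ->
  \sum_k \sum_l F k l = F i j + F j i.
Proof.
move=> ij F0; rewrite pair_big /= (bigD1 (i, j)) //= (bigD1 (j, i)) /=; last first.
  by rewrite xpair_eqE negb_and eq_sym ij.
by rewrite big1 ?addr0 // => -[k l] /andP[] /=; exact: F0.
Qed.

(** The Hessian at a frame [X] in a direction [X E] inside its span: the
    double sum only couples [E k l] with [E l k]. *)
Lemma frame_hessianE (R : realType) (p : nat) (mu : R) (s nu : 'rV[R]_p)
    (E : 'M[R]_p) :
  let B := diag_mx s *m E + E^T *m diag_mx s in
  2^-1 * frob_dot E (diag_mx s *m (diag_mx nu *m E - E *m diag_mx nu))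
    + mu / 4 * frob_dot B B
  = \sum_k \sum_l (2^-1 * (s 0 k * (nu 0 k - nu 0 l) * E k l ^+ 2)
      + mu / 4 * (s 0 k * E k l + s 0 l * E l k) ^+ 2).
Proof.
rewrite /= frob_dot_diag frob_dotE !mulr_sumr -big_split; apply: eq_bigr => k _.
rewrite !mulr_sumr -big_split; apply: eq_bigr => l _ /=.
by rewrite !(mul_diag_mx, mul_mx_diag) !mxE; ring.
Qed.

Section MinimizerIsEigenframe.
Context (R : realType) (n p : nat) (A : 'M[R]_n) (mu : R) (w : 'rV[R]_p)
  (X : 'M[R]_(n, p)).
Hypotheses (symA : A^T = A) (mu_gt0 : 0 < mu)
  (w_dec : forall i j : 'I_p, (i < j)%N -> w 0 j < w 0 i)
  (Xmin : local_minimizer (trace_penalty A mu (diag_mx w)) X).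

Let s : 'rV[R]_p := \row_i (X^T *m X) i i.
Let nu : 'rV[R]_p := mu *: (w - s).

(** By the gradient equation [mu G W = X^T A X + mu G^2] with [G = X^T X], and
    the right-hand side is symmetric; so [G] commutes with [W], which has
    distinct diagonal entries. *)
Lemma local_minimizer_gram : X^T *m X = diag_mx s.
Proof.
have [AX _] := local_minimizer_derivatives symA (tr_diag_mx w) Xmin.
set G := X^T *m X in AX *.
have symG : G^T = G by rewrite /G trmx_mul trmxK.
have GW : mu *: (G *m diag_mx w) = X^T *m A *m X + mu *: (G *m G).
  rewrite -mulmxA AX -scalemxAr mulmxA -/G mulmxBr scaleNr scalerBr.
  by rewrite opprB subrK.
have sE i : s 0 i = G i i by rewrite mxE.
clearbody G.
have trZ (M : 'M[R]_p) : (mu *: M)^T = mu *: M^T by rewrite linearZ.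
have trD (M N : 'M[R]_p) : (M + N)^T = M^T + N^T by rewrite linearD.
have comm : diag_mx w *m G = G *m diag_mx w.
  apply: (scalerI (lt0r_neq0 mu_gt0)); rewrite GW.
  rewrite -{1}symG -{1}(tr_diag_mx w) -trmx_mul -trZ GW trD trZ !trmx_mul.
  by rewrite trmxK symA symG mulmxA.
apply/matrixP => i j; rewrite mxE sE.
have [<- // | ij] := eqVneq i j.
have wij : w 0 i - w 0 j != 0.
  rewrite subr_eq0; move: ij; rewrite -val_eqE /= neq_ltn => /orP[] /w_dec.
    by rewrite eq_sym => /lt_eqF ->.
  by move=> /lt_eqF ->.
move/matrixP/(_ i j): comm; rewrite mul_diag_mx mul_mx_diag !mxE => e.
apply: (mulfI wij); rewrite mulr0 mulrBl e mulrC subrr //.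
Qed.

Lemma local_minimizer_eigen : A *m X = X *m diag_mx nu.
Proof.
have [-> _] := local_minimizer_derivatives symA (tr_diag_mx w) Xmin.
rewrite local_minimizer_gram -linearB /= scaleNr -scalerN -mulmxN.
rewrite -linearN /= opprB scalemxAr; congr (_ *m _).
by apply/matrixP => i j; rewrite !mxE -!mulrnAr.
Qed.

(** The Hessian in the direction that adds [u] to column [i] only: since [u]
    is orthogonal to all columns, the Gram matrix is unchanged at first
    order. *)
Lemma local_minimizer_perp (u : 'cV[R]_n) (i : 'I_p) :
  X^T *m u = 0 -> nu 0 i * frob_dot u u <= frob_dot u (A *m u).
Proof.
move=> Xu.
have [_ /(_ (u *m delta_mx 0 i))] :=
  local_minimizer_derivatives symA (tr_diag_mx w) Xmin.
have XH : X^T *m (u *m delta_mx 0 i) = 0 by rewrite mulmxA Xu mul0mx.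
have HX : (u *m delta_mx 0 i)^T *m X = 0.
  by rewrite -[LHS]trmxK trmx_mul trmxK XH trmx0.
rewrite XH HX /= addr0 frob_dot0r mulr0 addr0 pmulr_rge0 ?invr_gt0 //.
have HS : u *m delta_mx 0 i *m (X^T *m X - diag_mx w)
    = ((s 0 i - w 0 i) *: u) *m delta_mx 0 i.
  rewrite local_minimizer_gram -linearB /= -mulmxA -scalemxAl scalemxAr.
  congr (_ *m _); apply/matrixP => k l; rewrite mul_mx_diag !mxE.
  by have [-> | _] := eqVneq l i; rewrite ?andbF ?andbT /= mulrC ?mulr0.
rewrite HS scalemxAl mulmxA -mulmxDl frob_dot_mulr -mulmxA.
have -> : delta_mx 0 i *m (delta_mx 0 i)^T = 1%:M :> 'M[R]_1.
  by rewrite trmx_delta mul_delta_mx; apply/matrixP => k l; rewrite !ord1 !mxE.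
rewrite mulmx1 frob_dotDr !frob_dotZr /nu !mxE; lra.
Qed.

(** If column [i] were zero, row [i] of [X^T V] would be zero, so some nonzero
    [V c] would be orthogonal to all columns of [X].  Its Rayleigh quotient is
    at most [m], whereas the Hessian requires at least [mu w_i], the value of
    [nu_i] for a zero column. *)
Lemma local_minimizer_gram_gt0 (V : 'M[R]_(n, p)) (sV lam : 'rV[R]_p) (m : R) :
  eigenframe A V sV lam -> (forall k, lam 0 k <= m) ->
  (forall i, m < mu * w 0 i) -> forall i, 0 < s 0 i.
Proof.
move=> VF lam_le m_lt i.
have sE : s 0 i = \sum_k X k i ^+ 2.
  by rewrite !mxE; apply: eq_bigr => k _; rewrite mxE expr2.
rewrite lt_def sE sumr_ge0 ?andbT => [|k _]; last exact: sqr_ge0.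
apply/negP => /eqP sum0.
have Xi k : X k i = 0.
  apply/eqP; rewrite -sqrf_eq0; apply/eqP.
  by move: k (erefl true); apply/psumr_eq0P => // k _; exact: sqr_ge0.
have [j | c c_neq0 XVc] := @kernel_of_zero_row _ _ (X^T *m V) i.
  by rewrite mxE big1 // => k _; rewrite mxE Xi mul0r.
rewrite -mulmxA in XVc.
have Vc_gt0 := eigenframe_span_gt0 VF c_neq0.
have := le_trans (local_minimizer_perp i XVc)
  (eigenframe_rayleigh_le VF (fun k _ => lam_le k)).
rewrite ler_pM2r // /nu mxE (_ : (w - s) 0 i = w 0 i) ?leNgt ?m_lt //.
have -> : (w - s) 0 i = w 0 i - s 0 i by rewrite !mxE.
by rewrite sE sum0 subr0.
Qed.

(** In the direction [x_i += a x_j], [x_j += b x_i], the Hessian is half of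
    [delta (a^2 s_j - b^2 s_i) + mu (b s_i + a s_j)^2], where
    [delta = nu_j - nu_i].  As a quadratic form in the normalized amplitudes
    [a |x_j|] and [b |x_i|], the bracket has determinant [delta mu (w_i - w_j)]; as
    [w_i > w_j], it takes negative values if [delta < 0]. *)
Lemma local_minimizer_ordered (s_gt0 : forall i, 0 < s 0 i) (i j : 'I_p) :
  (i <= j)%N -> nu 0 i <= nu 0 j.
Proof.
rewrite leq_eqVlt => /orP[/eqP/val_inj -> // | ij].
rewrite leNgt; apply/negP => nu_lt.
have i_neq_j : i != j by rewrite -val_eqE /= ltn_eqF.
pose delta := nu 0 j - nu 0 i.
(* The direction that minimizes the form along one coordinate: [(r, - q)] for
   a form with matrix [(m, q; q, r)], here rescaled from the normalized
   amplitudes so that no square root appears. *)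
pose a := mu * s 0 i - delta; pose b := - (mu * s 0 j).
pose E : 'M[R]_p := a *: delta_mx j i + b *: delta_mx i j.
have Eji : E j i = a by rewrite !mxE !eqxx (negPf i_neq_j) andbF /= mulr1 mulr0 addr0.
have Eij : E i j = b.
  by rewrite !mxE !eqxx (negPf i_neq_j) /= mulr1 mulr0 add0r.
have E0 k l : (k, l) != (i, j) -> (k, l) != (j, i) -> E k l = 0.
  rewrite !xpair_eqE => /negPf kl1 /negPf kl2.
  by rewrite !mxE kl1 kl2 !mulr0 addr0.
have [_ /(_ (X *m E))] := local_minimizer_derivatives symA (tr_diag_mx w) Xmin.
have AH : A *m (X *m E) + mu *: (X *m E *m (X^T *m X - diag_mx w))
    = X *m (diag_mx nu *m E - E *m diag_mx nu).
  rewrite mulmxA local_minimizer_eigen local_minimizer_gram -linearB /=.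
  rewrite (mulmxBr X) !mulmxA; congr (_ + _).
  by rewrite scalemxAr -mulmxN -linearZ -linearN /nu -scalerN opprB.
have XE : X^T *m (X *m E) = diag_mx s *m E by rewrite mulmxA local_minimizer_gram.
have EX : (X *m E)^T *m X = E^T *m diag_mx s.
  by rewrite trmx_mul -mulmxA local_minimizer_gram.
rewrite /= AH XE EX frob_dot_mull (mulmxA X^T) local_minimizer_gram.
rewrite frame_hessianE (sum_two_entries i_neq_j); last first.
  move=> k l kl1 kl2; have [-> ->] : E k l = 0 /\ E l k = 0.
    by split; apply: E0; rewrite // xpair_eqE andbC -xpair_eqE.
  by ring.
rewrite Eij Eji => hess_ge0.
have neg : s 0 j * delta * a * (mu * (w 0 i - w 0 j)) < 0.
  have delta_lt0 : delta < 0 by rewrite subr_lt0.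
  rewrite pmulr_llt0; last by rewrite mulr_gt0 // subr_gt0 w_dec.
  rewrite pmulr_llt0; last by rewrite subr_gt0 (lt_trans delta_lt0) // mulr_gt0.
  by rewrite pmulr_rlt0.
have nuE k : nu 0 k = mu * (w 0 k - s 0 k) by rewrite !mxE.
move: hess_ge0 neg; rewrite /a /b /delta !nuE.
set si := s 0 i; set sj := s 0 j.
lra.
Qed.
End MinimizerIsEigenframe.

Lemma local_minimizer_lowest_eigenframe (R : realType) (n p : nat)
    (A : 'M[R]_n) (mu : R) (w : 'rV[R]_p) (V X : 'M[R]_(n, p))
    (sV lam : 'rV[R]_p) (m : R) :
  A^T = A -> 0 < mu -> (forall i j : 'I_p, (i < j)%N -> w 0 j < w 0 i) ->
  eigenframe A V sV lam -> (forall k, lam 0 k <= m) ->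
  (forall i, m < mu * w 0 i) ->
  local_minimizer (trace_penalty A mu (diag_mx w)) X ->
  exists s, lowest_eigenframe A X s (mu *: (w - s)).
Proof.
move=> symA mu_gt0 w_dec VF lam_le m_lt Xmin.
exists (\row_i (X^T *m X) i i).
have s_gt0 := local_minimizer_gram_gt0 symA mu_gt0 w_dec Xmin VF lam_le m_lt.
split; first split=> //.
- exact: (local_minimizer_gram symA mu_gt0 w_dec Xmin).
- exact: (local_minimizer_eigen symA mu_gt0 w_dec Xmin).
- exact: (local_minimizer_ordered symA mu_gt0 w_dec Xmin).
- exact: (local_minimizer_perp symA mu_gt0 w_dec Xmin).
Qed.

(** * Existence of a global minimizer *)

Lemma frob_dot_mul_ge (R : realType) (n p : nat) (A : 'M[R]_n) :
  exists C : R, forall Y : 'M[R]_(n, p),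
    - C * frob_dot Y Y <= frob_dot Y (A *m Y).
Proof.
exists (\sum_(i < n) \sum_(k < p) \sum_(j < n) `|A i j|) => Y.
rewrite [leRHS]frob_dotE mulNr mulr_suml -sumrN; apply: ler_sum => i _.
rewrite mulr_suml -sumrN; apply: ler_sum => k _.
rewrite mxE mulr_suml mulr_sumr -sumrN; apply: ler_sum => j _.
rewrite mulrCA -[leLHS]opprK lerNl opprK; apply: le_trans (ler_norm _) _.
rewrite normrN normrM ler_wpM2l //.
have := sqr_entry_le_frob_dot Y i k; have := sqr_entry_le_frob_dot Y j k.
by rewrite ler_norml; nra.
Qed.

(** The quartic term beats the quadratic one.  It is enough to replace it by
    its tangent: [|D|^2 >= 2 c tr D - c^2 |I|^2] with [D = Y^T Y - W], whose
    trace is [|Y|^2 - tr W]; the slope [c] is free. *)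
Lemma trace_penalty_coercive (R : realType) (n p : nat) (A : 'M[R]_n) (mu : R)
    (W : 'M[R]_p) :
  0 < mu -> exists K : R, forall Y : 'M[R]_(n, p),
    frob_dot Y Y - K <= trace_penalty A mu W Y.
Proof.
move=> mu_gt0; have [C CP] := frob_dot_mul_ge p A.
(* chosen so that [mu / 4 * (2 c) - C / 2 = 1] *)
pose c := (C + 2) / mu.
exists (mu / 4 * (2 * c * \tr W + c ^+ 2 * frob_dot (1%:M : 'M[R]_p) 1%:M)) => Y.
rewrite trace_penaltyE.
have := CP Y; have := frob_dot_ge0 (Y^T *m Y - W + (- c) *: 1%:M).
have : frob_dot 1%:M (Y^T *m Y - W) = frob_dot Y Y - \tr W.
  by rewrite /frob_dot trmx1 mul1mx linearB.
move: (Y^T *m Y - W) => D trD.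
rewrite !(frob_dotDl, frob_dotDr, frob_dotZl, frob_dotZr) (frob_dotC D 1%:M) trD.
move: (frob_dot Y Y) (frob_dot D D) (frob_dot 1%:M 1%:M) (\tr W) (frob_dot _ (A *m Y)).
move=> q d e t a D_ge q_ge.
have : mu / 4 * (2 * c * (q - t) - c ^+ 2 * e) <= mu / 4 * d.
  by rewrite ler_pM2l ?divr_gt0 //; lra.
have : mu / 4 * (2 * c * q) = (C + 2) / 2 * q by rewrite /c; field; lra.
lra.
Qed.

Lemma continuous_mulmx_entries (R : realType) (T : topologicalType)
    (m n q : nat) (F : T -> 'M[R]_(m, n)) (G : T -> 'M[R]_(n, q)) :
  (forall i j, continuous (fun t => F t i j)) ->
  (forall i j, continuous (fun t => G t i j)) ->
  forall i j, continuous (fun t => (F t *m G t) i j).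
Proof.
move=> cF cG i j; rewrite (_ : (fun _ => _) = fun t => \sum_k F t i k * G t k j).
  apply: continuous_big => [|k _]; first exact: add_continuous.
  by move=> t; apply: cvgM; [exact: cF | exact: cG].
by apply/funext => t; rewrite mxE.
Qed.

(** Stated along a parametrization [F] because the minimum is sought over row
    vectors, where boxes are products of compact intervals. *)
Lemma continuous_trace_penalty (R : realType) (T : topologicalType) (n p : nat)
    (A : 'M[R]_n) (mu : R) (W : 'M[R]_p) (F : T -> 'M[R]_(n, p)) :
  (forall i j, continuous (fun t => F t i j)) ->
  continuous (fun t => trace_penalty A mu W (F t)).
Proof.
move=> cF.
have cFT i j : continuous (fun t => (F t)^T i j).
  by rewrite (_ : (fun _ => _) = fun t => F t j i) //; apply/funext => t; rewrite mxE.
have cA i j : continuous ((fun=> A i j) : T -> R) by move=> t; exact: cvg_cst.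
have cgram := continuous_mulmx_entries cFT cF.
have cAF := continuous_mulmx_entries cFT (continuous_mulmx_entries (F := fun=> A) cA cF).
have csum m (f : T -> 'I_m -> R) :
    (forall i, continuous (f ^~ i)) -> continuous (fun t => \sum_i f t i).
  by move=> cf; apply: continuous_big => [|i _]; [exact: add_continuous | exact: cf].
rewrite (_ : (fun _ => _) = fun t =>
    2^-1 * (\sum_i ((F t)^T *m (A *m F t)) i i)
    + mu / 4 * \sum_i \sum_j (((F t)^T *m F t) i j - W i j) ^+ 2); last first.
  apply/funext => t; rewrite trace_penaltyE [frob_dot (_ - W) _]frob_dotE.
  congr (_ + _ * _); do 2![apply: eq_bigr => ? _]; rewrite !mxE expr2 //.
move=> t; apply: cvgD; apply: cvgM; try exact: cvg_cst.
  by apply: (csum) => i; exact: cAF.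
apply: (csum) => i; apply: (csum) => j {}t.
apply: (@cvg_comp _ _ _ _ (fun x : R => x ^+ 2)); last exact: exprn_continuous.
by apply: cvgB; [exact: cgram | exact: cvg_cst].
Qed.

(** Outside a large box the objective exceeds its value at [0], and on the
    box it attains its minimum by compactness. *)
Lemma trace_penalty_attains_min (R : realType) (n p : nat) (A : 'M[R]_n)
    (mu : R) (W : 'M[R]_p) :
  0 < mu -> exists Z : 'M[R]_(n, p), global_minimizer (trace_penalty A mu W) Z.
Proof.
move=> mu_gt0; have [K KP] := @trace_penalty_coercive R n p A mu W mu_gt0.
pose f (y : 'rV[R]_(n * p)) := trace_penalty A mu W (vec_mx y).
(* then [b^2 - K >= b - K >= f 0], as [b >= 1] *)
pose b := 1 + `|K| + `|f 0|.
have b_ge1 : 1 <= b by rewrite /b -addrA lerDl addr_ge0.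
pose box := [set v : 'rV[R]_(n * p) | forall i, `[- b, b]%classic (v ord0 i)].
have cbox : compact box.
  by apply: (@rV_compact _ _ (fun=> `[- b, b]%classic)) => _; exact: segment_compact.
have box0 : box 0 by move=> i /=; rewrite mxE in_itv /=; apply/andP; lra.
have cf : continuous f.
  apply: continuous_trace_penalty => i j.
  rewrite (_ : (fun _ => _) = fun v : 'rV[R]__ => v 0 (mxvec_index i j)).
    exact: coord_continuous.
  by apply/funext => v; rewrite mxE.
have [z zbox zmin] := compact_EVT_min (ex_intro _ 0 box0) cbox
  (continuous_subspaceT cf).
exists (vec_mx z) => Y.
rewrite -[Y]mxvecK -/(f _) -/(f (mxvec Y)); set y := mxvec Y.
have [ybox | ybox] := pselect (box y); first by apply: zmin; rewrite inE.
have : f z <= f 0 by apply: zmin; rewrite inE.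
move=> /le_trans; apply; have [i yi] : exists i, ~ `[- b, b]%classic (y ord0 i).
  by apply/existsNP.
have b2 : b ^+ 2 < frob_dot Y Y.
  case/mxvec_indexP: i yi => k l; rewrite mxvecE /= in_itv /= -ler_norml => /negP.
  rewrite -ltNge => b_lt; apply: lt_le_trans (sqr_entry_le_frob_dot Y k l).
  by rewrite -(real_normK (num_real (Y k l))); nra.
have := KP Y; rewrite (_ : trace_penalty A mu W Y = f y); last by rewrite /f mxvecK.
have := ler_norm K; have := ler_norm (f 0); have : b <= b ^+ 2 by nra.
by rewrite /b in b2 *; lra.
Qed.

(** * Comparing local minimizers *)

(** The term of index [i] is
    [mu / 2 (w_i - s_i) s_i + mu / 4 (s_i - w_i)^2]. *)
Lemma trace_penalty_eigenframe (R : realType) (n p : nat) (A : 'M[R]_n)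
    (mu : R) (w : 'rV[R]_p) (X : 'M[R]_(n, p)) (s : 'rV[R]_p) :
  eigenframe A X s (mu *: (w - s)) ->
  trace_penalty A mu (diag_mx w) X
  = mu / 4 * \sum_i (w 0 i ^+ 2 - s 0 i ^+ 2).
Proof.
case=> XX _ AX; rewrite trace_penaltyE AX XX -linearB /=.
rewrite /frob_dot mulmxA XX tr_diag_mx !mulmx_diag !mxtrace_diag !mulr_sumr.
by rewrite -big_split; apply: eq_bigr => i _; rewrite !mxE /=; field.
Qed.

(** Eigenvectors of a symmetric matrix for distinct eigenvalues are
    orthogonal. *)
Lemma simple_eigenvalues_eigenframe (R : realType) (n p : nat) (A : 'M[R]_n)
    (lam : 'rV[R]_p) :
  A^T = A -> (forall i, root (char_poly A) (lam 0 i)) ->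
  (forall i j, i != j -> lam 0 i != lam 0 j) ->
  exists (V : 'M[R]_(n, p)) (s : 'rV[R]_p), eigenframe A V s lam.
Proof.
move=> symA lam_root lam_inj.
have /choice[v vP] (i : 'I_p) :
    exists v : 'cV[R]_n, A *m v = lam 0 i *: v /\ v != 0.
  have := lam_root i; rewrite -eigenvalue_root_char => /eigenvalueP[u uA u_neq0].
  by exists u^T; rewrite trmx_eq0 -{1}symA -trmx_mul uA linearZ.
have v_orth i j : i != j -> frob_dot (v i) (v j) = 0.
  move=> /lam_inj lam_ij; have : lam 0 i - lam 0 j != 0 by rewrite subr_eq0.
  move/mulfI; apply; rewrite mulr0 mulrBl -frob_dotZl -frob_dotZr.
  by rewrite -(vP i).1 -(vP j).1 frob_dot_mull symA subrr.
exists (\matrix_(k, i) v i k 0), (\row_i frob_dot (v i) (v i)); split.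
- apply/matrixP => i j; rewrite !mxE.
  have -> : \sum_k (\matrix_(k, i) v i k 0)^T i k * (\matrix_(k, i) v i k 0) k j
      = frob_dot (v i) (v j).
    by rewrite frob_dotE; apply: eq_bigr => k _; rewrite big_ord1 !mxE.
  by have [-> | /v_orth ->] := eqVneq i j; rewrite ?mulr1n ?mulr0n.
- move=> i; rewrite mxE lt_def frob_dot_ge0 andbT.
  by apply: contraNneq (vP i).2 => /frob_dot_eq0 ->.
- apply/matrixP => k i; rewrite mul_mx_diag !mxE.
  move/matrixP/(_ k 0): (vP i).1; rewrite !mxE mulrC => <-.
  by apply: eq_bigr => l _; rewrite mxE.
Qed.

(* lam lists the eigenvalues of A with multiplicity; entries of lam and w are
   numbered from 0, so lam`_p.-1 is the p-th eigenvalue and w`_p.-1 the last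
   weight. *)
Theorem theorem2p3 (R : realType) (n p : nat) (A : 'M[R]_n)
    (lam : n.-tuple R) (mu : R) (w : p.-tuple R)
    (hp : (1 <= p)%N) (hpn : (p < n)%N)
    (hA : A \is symmetricmx)
    (hlam : char_poly A = \prod_(l <- lam) ('X - l%:P))
    (hlam_le : sorted <=%R lam)
    (hlam_lt : sorted <%R (take p.+1 lam))
    (hmu : 0 < mu)
    (hw : sorted >%R w)
    (hw_last : lam`_p.-1 / mu < w`_p.-1)
    (X : 'M[R]_(n, p)) :
  local_minimizer (trace_penalty A mu (diag_mx (\row_i tnth w i))) X ->
  global_minimizer (trace_penalty A mu (diag_mx (\row_i tnth w i))) X.
Proof.
set wr := \row_i tnth w i => Xmin.
have symA : A^T = A.
  by move/is_hermitianmxP: hA; rewrite expr0 scale1r map_mx_id // => <-.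
have wE i : wr 0 i = w`_i by rewrite mxE (tnth_nth 0).
have w_dec (i j : 'I_p) : (i < j)%N -> wr 0 j < wr 0 i.
  move=> ij; rewrite !wE.
  by apply: (sorted_ltn_nth (rev_trans lt_trans) 0 hw); rewrite // inE size_tuple.
pose lamr : 'rV[R]_p := \row_i lam`_i.
have last_lt : (p.-1 < p)%N by rewrite prednK.
have lam_lt_nth (i j : 'I_p) : (i < j)%N -> lamr 0 i < lamr 0 j.
  move=> ij; rewrite !mxE -(@nth_take p.+1 _ _ i) -1?(@nth_take p.+1 _ _ j);
    try by rewrite ltnS ltnW.
  apply: (sorted_ltn_nth lt_trans 0 hlam_lt); rewrite // inE size_takel ?size_tuple //;
    by rewrite ltnS ltnW.
have [V [sV VF]] : exists (V : 'M[R]_(n, p)) sV, eigenframe A V sV lamr.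
  apply: simple_eigenvalues_eigenframe => // [i | i j].
    rewrite hlam root_prod_XsubC mxE mem_nth // size_tuple.
    exact: ltn_trans (ltn_ord i) hpn.
  by rewrite -val_eqE /= neq_ltn => /orP[] /lam_lt_nth; [move/lt_eqF -> | move/gt_eqF ->].
have lam_le k : lamr 0 k <= lam`_p.-1.
  rewrite mxE; apply: (sorted_leq_nth le_trans le_refl 0 hlam_le).
  - by rewrite inE size_tuple (ltn_trans (ltn_ord k)).
  - by rewrite inE size_tuple (ltn_trans last_lt).
  - by rewrite -ltnS prednK.
have lam_lt i : lam`_p.-1 < mu * wr 0 i.
  rewrite mulrC -ltr_pdivrMr //; apply: lt_le_trans hw_last _.
  rewrite wE; have : (i <= p.-1)%N by rewrite -ltnS prednK.
  rewrite leq_eqVlt => /orP[/eqP -> // | ilt]; apply/ltW.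
  by have := w_dec i (Ordinal last_lt) ilt; rewrite !wE.
have frame (Y : 'M[R]_(n, p)) : local_minimizer (trace_penalty A mu (diag_mx wr)) Y ->
    exists s, lowest_eigenframe A Y s (mu *: (wr - s)).
  exact: (local_minimizer_lowest_eigenframe symA hmu w_dec VF lam_le lam_lt).
have [Z Zmin] := @trace_penalty_attains_min R n p A mu (diag_mx wr) hmu.
have [s XF] := frame X Xmin.
have [s' ZF] : exists s, lowest_eigenframe A Z s (mu *: (wr - s)).
  by apply: frame; apply: filterE => Y; exact: Zmin.
have ss' : s = s'.
  apply/matrixP => k i; rewrite ord1; apply/eqP; rewrite eq_le.
  have := lowest_eigenframe_le i symA XF ZF; have := lowest_eigenframe_le i symA ZF XF.
  by rewrite !mxE !ler_pM2l // !lerD2l !lerN2 => -> ->.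
move=> Y; apply: le_trans (Zmin Y).
have [XF0 _ _] := XF; have [ZF0 _ _] := ZF.
by rewrite (trace_penalty_eigenframe XF0) (trace_penalty_eigenframe ZF0) ss'.
Qed.
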